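(* Let $n\ge3$, $i\in\{1,\dots,n-2\}$, and let $\mathfrak T_{j,\cdot}$ denote either of the two families of operators $\mathfrak T^{R}_{j,\cdot}$, $\mathfrak T^{L}_{j,\cdot}$ on $\mathbb Z[z_1^{\pm1},\dots,z_n^{\pm1},y]$ (the same family throughout). For all $\lambda_1,\lambda_2,\lambda_3\in\mathbb Q$, $$\mathfrak T_{i,\lambda_3-\lambda_2}\circ\mathfrak T_{i+1,\lambda_3-\lambda_1}\circ\mathfrak T_{i,\lambda_2-\lambda_1}=\mathfrak T_{i+1,\lambda_2-\lambda_1}\circ\mathfrak T_{i,\lambda_3-\lambda_1}\circ\mathfrak T_{i+1,\lambda_3-\lambda_2}.$$
   Context: For $j\in\{1,\dots,n-1\}$ put $L_j=z_{j+1}/z_j$, and let $s_j$ act on Laurent polynomials $f\in\mathbb Z[z_1^{\pm1},\dots,z_n^{\pm1},y]$ by exchanging $z_j$ and $z_{j+1}$. For $a\in\mathbb Q$ define operators on $\mathbb Z[z_1^{\pm1},\dots,z_n^{\pm1},y]$ by $$\mathfrak T^{R}_{j,a}(f)=-\frac{(1+y)L_j^{\lceil a\rceil}f-(1+yL_j^{-1})\,s_jf}{1-L_j},\qquad \mathfrak T^{L}_{j,a}(f)=-\frac{(1+y)L_j^{\lceil a\rceil}f-(1+yL_j)\,s_jf}{1-L_j}$$ (the numerators are divisible by $1-L_j$). *)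

(* Defs.v *)
From HB Require Import structures.
From mathcomp Require Import all_boot all_order all_algebra perm.
From mathcomp Require Import boolp mpoly zify ring.

Set Implicit Arguments.
Unset Strict Implicit.
Unset Printing Implicit Defensive.

Import Order.TTheory GRing.Theory Num.Theory.
Local Open Scope ring_scope.

Local Notation "p %:F" := (@FracField.tofrac _ p).

(* The field Q(z_1, ..., z_n, y), as the fraction field of a polynomial ring
   in n.+1 variables: the variable of index j - 1 is z_j, the last one is y. *)
Notation ratfun n := {fraction {mpoly int[n.+1]}}.

Section Operators.
Variable n : nat.
Implicit Types (j : nat) (a : rat) (f : ratfun n).

Definition zvar j : ratfun n := ('X_(inord j.-1))%:F.
Definition yvar : ratfun n := ('X_ord_max)%:F.
Definition L j : ratfun n := zvar j.+1 / zvar j.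

(* s_j, extended to fractions; independent of the representative of f by
   swap_frac below *)
Definition swap j f : ratfun n :=
  let s : 'S_n.+1 := tperm (inord j.-1) (inord j) in
  (msym s (\n_(repr f)))%:F / (msym s (\d_(repr f)))%:F.

(* Z[z_1^{+-1}, ..., z_n^{+-1}, y]: the fractions with a power of z_1 ... z_n
   as denominator *)
Definition laurent_pred : {pred ratfun n} := fun f =>
  `[< exists k (p : {mpoly int[n.+1]}),
        f = p%:F / (\prod_(1 <= j < n.+1) zvar j) ^+ k >].

Definition TR_frac j a f : ratfun n :=
  - (((1 + yvar) * L j ^ Num.ceil a * f - (1 + yvar * (L j)^-1) * swap j f)
     / (1 - L j)).

Definition TL_frac j a f : ratfun n :=
  - (((1 + yvar) * L j ^ Num.ceil a * f - (1 + yvar * L j) * swap j f)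
     / (1 - L j)).

End Operators.

Lemma frac_numden (R : idomainType) (x : {fraction R}) :
  x = (\n_(repr x))%:F / (\d_(repr x))%:F.
Proof.
have d0 := denom_ratioP (repr x).
apply: (mulIf (x := (\d_(repr x))%:F)); first by rewrite tofrac_eq0.
rewrite mulfVK ?tofrac_eq0 //; rewrite -{1}[x]reprK.
unlock FracField.tofrac; rewrite -[LHS]FracField.pi_mul.
rewrite /FracField.mulf !numden_Ratio ?oner_eq0 // !mulr1.
apply/eqmodP; rewrite /= FracField.equivfE.
by rewrite !numden_Ratio ?oner_eq0 // mulr1 mulrC.
Qed.

Section RatfunTheory.
Variable n : nat.
Implicit Types (j : nat) (a : rat) (f g : ratfun n) (p q : {mpoly int[n.+1]}).

Lemma ratfunE f : f = (\n_(repr f))%:F / (\d_(repr f))%:F.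
Proof. exact: frac_numden. Qed.

Lemma swap_frac j p q : q != 0 ->
  swap j (p%:F / q%:F : ratfun n) =
  (msym (tperm (inord j.-1) (inord j)) p)%:F /
  (msym (tperm (inord j.-1) (inord j)) q)%:F.
Proof.
move=> q0; rewrite /swap; set f : ratfun n := p%:F / q%:F.
set s := tperm _ _.
have d0 := denom_ratioP (repr f).
have ms0 r : r != 0 -> (msym s r)%:F != 0 :> ratfun n.
  by move=> r0; rewrite tofrac_eq0 -(msym0 _ s) (inj_eq (inj_msym s)).
apply/eqP; rewrite eqr_div ?ms0 // -!tofracM tofrac_eq -!msymM.
apply/eqP; congr (msym s _); apply/eqP; rewrite -tofrac_eq !tofracM.
by rewrite -eqr_div ?tofrac_eq0 // -ratfunE.
Qed.

Lemma swap_tofrac j p :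
  swap j (p%:F : ratfun n) = (msym (tperm (inord j.-1) (inord j)) p)%:F.
Proof.
have := @swap_frac j p 1 (oner_neq0 _).
by rewrite msym1 !tofrac1 !divr1.
Qed.

Lemma msym_neq0 (s : 'S_n.+1) q : q != 0 -> msym s q != 0.
Proof. by move=> q0; rewrite -(msym0 _ s) (inj_eq (inj_msym s)). Qed.

(* unfolding swap makes unification very slow *)
Opaque swap.

Lemma msymX1 (s : 'S_n.+1) i : msym s 'X_i = 'X_(s i) :> {mpoly int[n.+1]}.
Proof. by rewrite /msym mmapX mmap1U. Qed.

Lemma swap_is_zmod_morphism j : zmod_morphism (@swap n j).
Proof.
move=> f g; rewrite (ratfunE f) (ratfunE g).
move: (denom_ratioP (repr f)) (denom_ratioP (repr g)).
move: (repr f).1 (repr f).2 (repr g).1 (repr g).2 => a b c d b0 d0.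
rewrite -mulNr addf_div ?tofrac_eq0 // -tofracN -!tofracM -tofracD.
rewrite !swap_frac ?mulf_neq0 // -[RHS]/(_ + _) -mulNr addf_div;
  rewrite ?tofrac_eq0 ?msym_neq0 //.
by rewrite -tofracN -!tofracM -tofracD msymD !msymM msymN.
Qed.

Lemma swap_is_monoid_morphism j : monoid_morphism (@swap n j).
Proof.
split=> [|f g]; first by rewrite -tofrac1 swap_tofrac msym1.
rewrite (ratfunE f) (ratfunE g).
move: (denom_ratioP (repr f)) (denom_ratioP (repr g)).
move: (repr f).1 (repr f).2 (repr g).1 (repr g).2 => a b c d b0 d0.
rewrite mulf_div -!tofracM !swap_frac ?mulf_neq0 //.
by rewrite mulf_div -!tofracM !msymM.
Qed.

HB.instance Definition _ j :=
  GRing.isZmodMorphism.Build (ratfun n) (ratfun n) (@swap n j)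
    (swap_is_zmod_morphism j).
HB.instance Definition _ j :=
  GRing.isMonoidMorphism.Build (ratfun n) (ratfun n) (@swap n j)
    (swap_is_monoid_morphism j).

Let swapD j : {morph @swap n j : f g / f + g}.
Proof. exact: (rmorphD (@swap n j : {rmorphism _ -> _})). Qed.

Let swapM j : {morph @swap n j : f g / f * g}.
Proof. exact: (rmorphM (@swap n j : {rmorphism _ -> _})). Qed.

Lemma laurentP f :
  reflect (exists k (p : {mpoly int[n.+1]}),
             f = p%:F / (\prod_(1 <= j < n.+1) zvar n j) ^+ k)
          (f \in @laurent_pred n).
Proof. exact: asboolP. Qed.

Lemma mpolyX1_inj : injective (fun i => 'X_i : {mpoly int[n.+1]}).
Proof.
move=> i k /mpolyP /(_ U_(i)%MM); rewrite !mcoeffX !eq_mnm1 eqxx.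
by case: eqP => // ->.
Qed.

Lemma mpolyX1_neq0 i : 'X_i != 0 :> {mpoly int[n.+1]}.
Proof.
by apply/eqP=> /mpolyP /(_ U_(i)%MM); rewrite mcoeffX eqxx mcoeff0.
Qed.

Lemma zvar_neq0 j : zvar n j != 0.
Proof. by rewrite tofrac_eq0 mpolyX1_neq0. Qed.

Lemma zprod_neq0 : \prod_(1 <= j < n.+1) zvar n j != 0.
Proof. by rewrite prodf_seq_neq0; apply/allP=> j _; rewrite zvar_neq0. Qed.

Lemma zprodE : \prod_(1 <= j < n.+1) zvar n j =
  (\prod_(1 <= j < n.+1) 'X_(inord j.-1) : {mpoly int[n.+1]})%:F.
Proof. by rewrite rmorph_prod. Qed.

Lemma laurent_subring_closed : subring_closed (@laurent_pred n).
Proof.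
have Z0 := zprod_neq0; split.
- by apply/laurentP; exists 0, 1; rewrite expr0 divr1 tofrac1.
- move=> f g /laurentP[k [p ->]] /laurentP[l [q ->]]; apply/laurentP.
  set Z := \prod_(1 <= j < n.+1) _ in Z0 *.
  set P : {mpoly int[n.+1]} := \prod_(1 <= j < n.+1) 'X_(inord j.-1).
  exists (k + l)%N, (p * P ^+ l - q * P ^+ k).
  rewrite tofracB !tofracM !tofracXn -zprodE -/Z exprD.
  rewrite -[X in X = _]/(_ + _) -mulNr addf_div ?expf_neq0 //.
  by rewrite mulNr.
- move=> f g /laurentP[k [p ->]] /laurentP[l [q ->]]; apply/laurentP.
  by exists (k + l)%N, (p * q); rewrite mulf_div -tofracM exprD.
Qed.

HB.instance Definition _ :=
  GRing.isSubringClosed.Build (ratfun n) (@laurent_pred n)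
    laurent_subring_closed.

Lemma laurent_tofrac p : p%:F \in @laurent_pred n.
Proof. by apply/laurentP; exists 0, p; rewrite expr0 divr1. Qed.

Lemma laurent_zprodV : (\prod_(1 <= j < n.+1) zvar n j)^-1 \in @laurent_pred n.
Proof. by apply/laurentP; exists 1, 1; rewrite tofrac1 mul1r. Qed.

Lemma laurent_zvar j : zvar n j \in @laurent_pred n.
Proof. exact: laurent_tofrac. Qed.

Lemma laurent_yvar : yvar n \in @laurent_pred n.
Proof. exact: laurent_tofrac. Qed.

Lemma laurent_zvarV j : (0 < j <= n)%N -> (zvar n j)^-1 \in @laurent_pred n.
Proof.
move=> jn.
suff -> : (zvar n j)^-1 = (\prod_(1 <= k < n.+1 | k != j) zvar n k) *
                          (\prod_(1 <= k < n.+1) zvar n k)^-1.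
  by rewrite rpredM ?laurent_zprodV // rpred_prod // => k _; exact: laurent_zvar.
rewrite [X in _ * X^-1](bigD1_seq j) /= ?iota_uniq ?mem_index_iota //.
rewrite invfM mulrCA mulfV ?mulr1 // prodf_seq_neq0.
by apply/allP=> k _; rewrite zvar_neq0 implybT.
Qed.

Lemma inord_inj i j : (i <= n)%N -> (j <= n)%N -> inord i = inord j :> 'I_n.+1 -> i = j.
Proof. by move=> iN jN /(congr1 val) /=; rewrite !inordK. Qed.

Lemma subr1L_neq0 j : (0 < j < n)%N -> 1 - L n j != 0.
Proof.
move=> /andP[j0 jn]; rewrite subr_eq0 eq_sym; apply/eqP=> /divr1_eq.
move=> /eqP; rewrite tofrac_eq => /eqP /mpolyX1_inj /inord_inj.
lia.
Qed.

Lemma swap_zvarl j : (0 < j < n)%N -> swap j (zvar n j) = zvar n j.+1.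
Proof. by move=> jn; rewrite swap_tofrac msymX1 tpermL. Qed.

Lemma swap_zvarr j : (0 < j < n)%N -> swap j (zvar n j.+1) = zvar n j.
Proof. by move=> jn; rewrite swap_tofrac msymX1 tpermR. Qed.

Lemma swap_zvar j k : (0 < j < n)%N -> (0 < k <= n)%N -> k != j -> k != j.+1 ->
  swap j (zvar n k) = zvar n k.
Proof.
move=> jn kn kj kj1; rewrite swap_tofrac msymX1 tpermD //.
  by apply/eqP=> /inord_inj; lia.
by apply/eqP=> /inord_inj; lia.
Qed.

Lemma swap_yvar j : (0 < j < n)%N -> swap j (yvar n) = yvar n.
Proof.
move=> jn; rewrite swap_tofrac msymX1 tpermD //;
  by apply/eqP=> /(congr1 val) /=; rewrite inordK; lia.
Qed.

Lemma swap_zprod j : (0 < j < n)%N ->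
  swap j (\prod_(1 <= k < n.+1) zvar n k) = \prod_(1 <= k < n.+1) zvar n k.
Proof.
move=> jn.
have y0 : yvar n != 0 by rewrite tofrac_eq0 mpolyX1_neq0.
have E : (\prod_(1 <= k < n.+1) zvar n k) * yvar n
         = (\prod_(i < n.+1) 'X_i : {mpoly int[n.+1]})%:F.
  rewrite rmorph_prod big_ord_recr /= big_add1 /= big_mkord; congr (_ * _).
  apply: eq_bigr => i _; rewrite /zvar /=; congr ('X_ _)%:F.
  by apply: val_inj; rewrite /= inordK //; have := ltn_ord i; lia.
have := congr1 (swap j) E; rewrite rmorphM /= swap_yvar // swap_tofrac => Es.
apply: (mulIf y0); rewrite Es E.
congr (_ %:F); rewrite rmorph_prod /=.
rewrite [RHS](reindex_inj (@perm_inj _ (tperm (inord j.-1) (inord j)))) /=.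
by apply: eq_bigr => i _; rewrite msymX1.
Qed.

Section Divisibility.
Variable j : nat.
Hypothesis jn : (0 < j < n)%N.
Local Notation A := (@laurent_pred n).

Let good f := [/\ f \in A, swap j f \in A & (f - swap j f) / (1 - L n j) \in A].

Lemma laurent_L : L n j \in A.
Proof. by rewrite rpredM ?laurent_zvar ?laurent_zvarV //; lia. Qed.

Lemma laurent_LV : (L n j)^-1 \in A.
Proof. by rewrite invf_div rpredM ?laurent_zvar ?laurent_zvarV //; lia. Qed.

Lemma laurent_Lz (c : int) : L n j ^ c \in A.
Proof.
by case: c => k; rewrite ?NegzE -?exprnP -?exprnN -?exprVn rpredX
  ?laurent_L ?laurent_LV.
Qed.

Let goodD f g : good f -> good g -> good (f + g).
Proof.
case=> f1 f2 f3 [g1 g2 g3]; split; first exact: (rpredD f1 g1).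
  by rewrite swapD; exact: (rpredD f2 g2).
by rewrite swapD opprD addrACA mulrDl; exact: (rpredD f3 g3).
Qed.

Let goodM f g : good f -> good g -> good (f * g).
Proof.
case=> f1 f2 f3 [g1 g2 g3]; split; first exact: (rpredM f1 g1).
  by rewrite swapM; exact: (rpredM f2 g2).
have -> : f * g - swap j (f * g) =
   (f - swap j f) * g + swap j f * (g - swap j g).
  by rewrite swapM mulrBl mulrBr addrA subrK.
rewrite mulrDl mulrAC [X in X + _]mulrC; apply: rpredD; first exact: (rpredM g1 f3).
by rewrite -mulrA; exact: (rpredM f2 g3).
Qed.

Let good_fix f : f \in A -> swap j f = f -> good f.
Proof. by move=> fA sf; rewrite /good sf subrr mul0r rpred0. Qed.

Let good_X i : good ('X_i : {mpoly int[n.+1]})%:F.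
Proof.
have z0 := zvar_neq0 j; have L0 := subr1L_neq0 jn.
have E : zvar n j - zvar n j.+1 = zvar n j * (1 - L n j).
  by rewrite mulrBr mulr1 mulrC divfK.
split; rewrite ?swap_tofrac ?laurent_tofrac // msymX1.
case: tpermP => [-> | -> | _ _]; last by rewrite subrr mul0r rpred0.
  by rewrite -[_ - _]/(zvar n j - zvar n j.+1) E mulfK ?laurent_zvar.
rewrite -[_ - _]/(zvar n j.+1 - zvar n j) -opprB E -mulNr mulfK //.
by rewrite rpredN laurent_zvar.
Qed.

Let good_tofrac p : good p%:F.
Proof.
have good0 : good 0 by apply: good_fix; rewrite ?rpred0 ?rmorph0.
elim/mpolyind: p => [|c m p _ _ IH]; first by rewrite tofrac0; exact: good0.
rewrite tofracD; apply: (goodD _ IH).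
rewrite -(intz c) scaler_int rmorphMz -mulrzl; apply: goodM.
  by apply: good_fix; rewrite ?rpred_int ?rmorph_int.
have good1 : good 1 by apply: good_fix; rewrite ?rpred1 ?rmorph1.
rewrite mpolyXE_id rmorph_prod.
elim/big_ind: _ => [|f g|i _]; [exact: good1 | exact: goodM |].
rewrite rmorphXn /=; elim: (m i) => [|k IHk]; first by rewrite expr0; exact: good1.
by rewrite exprS; exact: (goodM (good_X i) IHk).
Qed.

Let good_laurent f : f \in A -> good f.
Proof.
case/laurentP=> k [p ->]; apply: goodM => //.
rewrite -exprVn; apply: good_fix; first by rewrite rpredX ?laurent_zprodV.
by rewrite rmorphXn /= fmorphV /= swap_zprod.
Qed.

Lemma laurent_swap f : f \in A -> swap j f \in A.
Proof. by case/good_laurent. Qed.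

Let Lz_div (c : int) : (L n j ^ c - 1) / (1 - L n j) \in A.
Proof.
have L0 := subr1L_neq0 jn.
have nat_case k : (L n j ^+ k - 1) / (1 - L n j) \in A.
  rewrite subrX1 -opprB mulNr mulNr rpredN mulrAC mulfV // mul1r.
  by apply: rpred_sum => i _; rewrite rpredX ?laurent_L.
case: c => k; first exact: nat_case.
have Lk0 : L n j ^+ k.+1 != 0 by rewrite expf_neq0 ?mulf_neq0 ?invr_eq0 ?zvar_neq0.
rewrite NegzE -exprnN.
have -> : (L n j ^+ k.+1)^-1 - 1 = - ((L n j ^+ k.+1 - 1) * (L n j ^+ k.+1)^-1).
  by rewrite mulrBl mul1r mulfV // opprB.
rewrite mulNr mulrAC rpredN; apply: (rpredM (nat_case k.+1)).
by rewrite -exprVn rpredX ?laurent_LV.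
Qed.

(* the numerators are divisible by 1 - L_j *)
Lemma laurent_numerator_div (c e : int) f : f \in A ->
  ((1 + yvar n) * L n j ^ c * f - (1 + yvar n * L n j ^ e) * swap j f)
   / (1 - L n j) \in A.
Proof.
move=> fA; have [_ sfA dfA] := good_laurent fA.
have -> : (1 + yvar n) * L n j ^ c * f - (1 + yvar n * L n j ^ e) * swap j f
  = (L n j ^ c - 1) * ((1 + yvar n) * f) + (f - swap j f) * (1 + yvar n)
    - (L n j ^ e - 1) * (yvar n * swap j f) by ring.
have yA : 1 + yvar n \in A by rewrite rpredD ?rpred1 ?laurent_yvar.
rewrite mulrBl mulrDl; apply: rpredB; first apply: rpredD.
- by rewrite mulrAC; exact: (rpredM (Lz_div c) (rpredM yA fA)).
- by rewrite mulrAC; exact: (rpredM dfA yA).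
- by rewrite mulrAC; exact: (rpredM (Lz_div e) (rpredM laurent_yvar sfA)).
Qed.

Lemma laurent_TR_frac a f : f \in A -> TR_frac j a f \in A.
Proof. by move=> fA; rewrite rpredN (laurent_numerator_div _ (-1)). Qed.

Lemma laurent_TL_frac a f : f \in A -> TL_frac j a f \in A.
Proof. by move=> fA; rewrite rpredN (laurent_numerator_div _ 1). Qed.

End Divisibility.

End RatfunTheory.

Section Laurent.
Variable n : nat.

Record laurent := Laurent {
  laurent_val :> ratfun n;
  _ : laurent_val \in @laurent_pred n }.

HB.instance Definition _ := [isSub for laurent_val].
HB.instance Definition _ := [Choice of laurent by <:].
HB.instance Definition _ := [SubChoice_isSubComNzRing of laurent by <:].

(* The default value 0 is only reached for j outside of 1, ..., n - 1. *)
Definition TR (j : nat) (a : rat) (f : laurent) : laurent :=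
  insubd (0 : laurent) (TR_frac j a (val f)).

Definition TL (j : nat) (a : rat) (f : laurent) : laurent :=
  insubd (0 : laurent) (TL_frac j a (val f)).

Lemma val_TR j a f : (0 < j < n)%N -> val (TR j a f) = TR_frac j a (val f).
Proof. by move=> jn; rewrite insubdK //; apply: laurent_TR_frac => //; exact: (valP f). Qed.

Lemma val_TL j a f : (0 < j < n)%N -> val (TL j a f) = TL_frac j a (val f).
Proof. by move=> jn; rewrite insubdK //; apply: laurent_TL_frac => //; exact: (valP f). Qed.

End Laurent.

(* Main.v *)
Require Import Defs.
From mathcomp Require Import all_boot all_order all_algebra.
From mathcomp Require Import perm mpoly zify ring lra.

Import Order.TTheory GRing.Theory Num.Theory.
Local Open Scope ring_scope.

(** The proof takes place in the field of rational functions, which contains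
the Laurent polynomials, so that the divisions by 1 - L_j are harmless.  There
both families have the form
  T_{j,a} f = A(L_j, ceil a) f + B(L_j) s_j f,
where A(u, p) = - (1 + y) u^p / (1 - u) and B(u) = (1 + y u^e) / (1 - u), with
e = -1 for the family R and e = 1 for the family L.

Write s, t for the two adjacent transpositions, u = L_i and v = L_{i+1}.  They
act by s u = u^-1, t v = v^-1 and s v = t u = u v.  Pushing s and t to the
right writes each triple composition as a combination of 1, s, t, st, ts and
sts = tst with coefficients in the field (demazure_lusztig_comp3), and
the two combinations are compared coefficient by coefficient.  The right hand
side arises from the left one by exchanging (s, u) with (t, v) and the
first exponent with the last, so a single expansion serves both sides.
  - The coefficients of st, ts and sts agree because multiplication is
    commutative.
  - Those of s and t agree by a three-term relation between values of A
    (diag_coef_three_term).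
  - That of 1 has to be symmetric in u and v (identity_coef_sym).  The sign e
    enters here only through B(u) B(u^-1), which is the same for e = 1
    and e = -1 (refl_coef_prod); this is why both families obey the relation.

If p, q, r are the ceilings of the three parameters lambda_2 - lambda_1,
lambda_3 - lambda_2 and their sum lambda_3 - lambda_1, then p + q - r is 0 or 1
(ceilD_sub01).  For each of these two values, and not in general, the last two
families of identities hold. *)

(** * Ceilings *)

Lemma ceilD_sub01 (x y : rat) :
  exists d : bool, Num.ceil x + Num.ceil y = Num.ceil (x + y) + d%:Z.
Proof.
move: (ceil_itv x) (ceil_itv y).
move: (Num.ceil x) (Num.ceil y) => m n /andP[lx ux] /andP[ly uy].
rewrite !rmorphB /= in lx ly.
have [le|gt] := boolP (x + y <= (m + n - 1)%:~R).
  exists true; suff -> : Num.ceil (x + y) = m + n - 1 by rewrite subrK.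
  apply: ceil_def; rewrite le andbT.
  by rewrite !(rmorphB, rmorphD) /=; lra.
exists false; rewrite addr0; apply/esym/ceil_def.
rewrite ltNge gt /= rmorphD /=; lra.
Qed.

(** * The braid relation over a field with two involutions *)

Definition diag_coef (F : fieldType) (y u : F) (p : int) : F :=
  - ((1 + y) * u ^ p / (1 - u)).

Definition refl_coef (F : fieldType) (y : F) (e : int) (u : F) : F :=
  (1 + y * u ^ e) / (1 - u).

(** This common shape of the two families has p = ceil a, u = L_j, and
e = -1 (family R) or e = 1 (family L). *)
Definition demazure_lusztig (F : fieldType) (s : F -> F) (y : F) (e : int)
    (u : F) (p : int) (f : F) : F :=
  diag_coef F y u p * f + refl_coef F y e u * s f.

Lemma subr_neq0C (F : fieldType) (u v : F) : (u - v != 0) = (v - u != 0).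
Proof. by rewrite -opprB oppr_eq0. Qed.

(** For either sign the product of the two numerators is
1 + y (u + u^-1) + y^2, and (1 - u) (1 - u^-1) = - u^-1 (1 - u)^2; splitting off
- y isolates the only part that depends on u. *)
Lemma refl_coef_prod (F : fieldType) (y u : F) (e : int) :
  e = 1 \/ e = -1 -> u != 0 -> 1 - u != 0 ->
  refl_coef F y e u * refl_coef F y e u^-1
  = - (y + u * (1 + y) ^+ 2 / (1 - u) ^+ 2).
Proof.
move=> e1 u0 u1; have u1' := u1; rewrite subr_neq0C in u1'.
by case: e1 => ->; rewrite /refl_coef -?expfV ?expr1z ?exprN1 ?invrK;
  field; rewrite ?u0 ?u1 ?u1'.
Qed.

(** The equality of the coefficients of s (and, with u and v exchanged, of t).
After division by (1 + y)^2 u^q v^r and clearing of the denominators it reads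
(1 - u v) - u^(1 - d) (1 - v) = v^d (1 - u), which is true for d = 0 and d = 1. *)
Lemma diag_coef_three_term (F : fieldType) (y u v : F) (p q r : int) (d : bool) :
  p + q = r + d%:Z ->
  u != 0 -> v != 0 -> 1 - u != 0 -> 1 - v != 0 -> 1 - u * v != 0 ->
  diag_coef F y u q * diag_coef F y v r
    + diag_coef F y (u * v) r * diag_coef F y u^-1 p
  = diag_coef F y v p * diag_coef F y (u * v) q.
Proof.
move=> pqr u0 v0 u1 v1 uv1; have u1' := u1; rewrite subr_neq0C in u1'.
have -> : p = r - q + d%:Z by lia.
rewrite /diag_coef -?expfV !expfzMl !expfzDr // -!invr_expz.
have := expfz_neq0 q u0; have := expfz_neq0 q v0.
have := expfz_neq0 r u0; have := expfz_neq0 r v0.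
move: (u ^ q) (v ^ q) (u ^ r) (v ^ r) => uq vq ur vr vr0 ur0 vq0 uq0.
by case: d {pqr} => /=; rewrite ?expr1z ?expr0z; field;
  rewrite ?u0 ?v0 ?u1 ?v1 ?uv1 ?u1' ?uq0 ?vq0 ?ur0 ?vr0.
Qed.

(** The equality of the coefficients of the identity.  By refl_coef_prod the
part - y A(u v, r) is common to both sides.  The rest of the left hand side is
- (1 + y)^3 (u v)^r times
(u^d (1 - u v) - u (1 - v)) / ((1 - u)^2 (1 - v) (1 - u v)), that is,
(u v)^d / ((1 - u) (1 - v) (1 - u v)) for d = 0 and d = 1: it is symmetric. *)
Lemma identity_coef_sym (F : fieldType) (y u v : F) (p q r : int) (d : bool) (e : int) :
  e = 1 \/ e = -1 -> p + q = r + d%:Z ->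
  u != 0 -> v != 0 -> 1 - u != 0 -> 1 - v != 0 -> 1 - u * v != 0 ->
  diag_coef F y u q * diag_coef F y v r * diag_coef F y u p
    + refl_coef F y e u * refl_coef F y e u^-1 * diag_coef F y (u * v) r
  = diag_coef F y v p * diag_coef F y u r * diag_coef F y v q
    + refl_coef F y e v * refl_coef F y e v^-1 * diag_coef F y (u * v) r.
Proof.
move=> e1 pqr u0 v0 u1 v1 uv1.
rewrite !refl_coef_prod // /diag_coef.
have -> : p = r - q + d%:Z by lia.
rewrite !expfzMl !expfzDr // -!invr_expz.
have := expfz_neq0 q u0; have := expfz_neq0 q v0.
have := expfz_neq0 r u0; have := expfz_neq0 r v0.
move: (u ^ q) (v ^ q) (u ^ r) (v ^ r) => uq vq ur vr vr0 ur0 vq0 uq0.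
by case: d {pqr} => /=; rewrite ?expr1z ?expr0z; field;
  rewrite ?u0 ?v0 ?u1 ?v1 ?uv1 ?uq0 ?vq0 ?ur0 ?vr0.
Qed.

Lemma rmorph_diag_coef (F : fieldType) (s : {rmorphism F -> F}) (y u : F) (p : int) :
  s y = y -> s (diag_coef F y u p) = diag_coef F y (s u) p.
Proof.
by move=> sy; rewrite /diag_coef rmorphN fmorph_div rmorphM rmorphD rmorphB
  !rmorph1 fmorphXz sy.
Qed.

Lemma rmorph_refl_coef (F : fieldType) (s : {rmorphism F -> F}) (y u : F) (e : int) :
  s y = y -> s (refl_coef F y e u) = refl_coef F y e (s u).
Proof.
by move=> sy; rewrite /refl_coef fmorph_div rmorphD rmorphM rmorphB
  !rmorph1 fmorphXz sy.
Qed.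

(** The expansion along 1, s, t, st, ts, sts.  The identity s (u v) = v makes
the argument of every coefficient one of u, v, u v and u^-1. *)
Lemma demazure_lusztig_comp3 (F : fieldType) (s t : {rmorphism F -> F})
    (y u v : F) (e p q r : int) (f : F) :
  involutive s -> s y = y -> t y = y -> u != 0 ->
  s u = u^-1 -> s v = u * v -> t u = u * v ->
  let a := diag_coef F y in let b := refl_coef F y e in
  demazure_lusztig F s y e u q
    (demazure_lusztig F t y e v r (demazure_lusztig F s y e u p f))
  = (a u q * a v r * a u p + b u * b u^-1 * a (u * v) r) * f
    + b u * (a u q * a v r + a (u * v) r * a u^-1 p) * s f
    + b v * (a u q * a (u * v) p) * t f
    + b u * b (u * v) * a v p * s (t f)
    + a u q * b v * b (u * v) * t (s f)
    + b u * b (u * v) * b v * s (t (s f)).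
Proof.
move=> ss sy ty u0 su sv tu a b.
have suv : s (u * v) = v by rewrite rmorphM su sv mulKf.
rewrite /demazure_lusztig.
have sa x m : s (a x m) = a (s x) m := rmorph_diag_coef F s y x m sy.
have ta x m : t (a x m) = a (t x) m := rmorph_diag_coef F t y x m ty.
have sb x : s (b x) = b (s x) := rmorph_refl_coef F s y x e sy.
have tb x : t (b x) = b (t x) := rmorph_refl_coef F t y x e ty.
rewrite -/a -/b; move: a b sa ta sb tb => a b sa ta sb tb.
rewrite !(rmorphM, rmorphD, sa, ta, sb, tb) /= ss !(su, tu, suv, sv).
ring.
Qed.

Lemma demazure_lusztig_braid (F : fieldType) (s t : {rmorphism F -> F})
    (y u v : F) (e p q r : int) (d : bool) (f : F) :
  e = 1 \/ e = -1 -> p + q = r + d%:Z ->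
  involutive s -> involutive t -> (forall g, s (t (s g)) = t (s (t g))) ->
  s y = y -> t y = y -> s u = u^-1 -> t v = v^-1 -> s v = u * v -> t u = u * v ->
  u != 0 -> v != 0 -> 1 - u != 0 -> 1 - v != 0 -> 1 - u * v != 0 ->
  demazure_lusztig F s y e u q
    (demazure_lusztig F t y e v r (demazure_lusztig F s y e u p f))
  = demazure_lusztig F t y e v p
      (demazure_lusztig F s y e u r (demazure_lusztig F t y e v q f)).
Proof.
move=> e1 pqr ss tt sts sy ty su tv sv tu u0 v0 u1 v1 uv1.
(* The right hand side is the expansion with (s, u, p) and (t, v, q) exchanged. *)
have qpr : q + p = r + d%:Z by rewrite addrC.
rewrite demazure_lusztig_comp3 // demazure_lusztig_comp3 // 1?mulrC //.
rewrite (identity_coef_sym _ _ _ _ _ _ _ _ _ e1 pqr) //.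
rewrite (diag_coef_three_term _ _ _ _ _ _ _ _ pqr) //.
rewrite [v * u]mulrC.
have E := diag_coef_three_term _ y _ _ _ _ _ _ qpr v0 u0 v1 u1.
rewrite [v * u]mulrC in E; rewrite (E uv1) sts.
ring.
Qed.

(** * The transpositions of variables *)

(** Both sides are the transposition of a and c. *)
Lemma tperm_braid (T : finType) (a b c : T) : a != b -> b != c -> a != c ->
  (tperm a b * tperm b c * tperm a b = tperm b c * tperm a b * tperm b c)%g.
Proof.
move=> ab bc ac.
have E x y z : x != y -> y != z -> x != z ->
    (tperm x y * tperm y z * tperm x y = tperm x z)%g.
  move=> xy yz xz.
  by have := tpermJ y z (tperm x y);
    rewrite tpermR tpermD // conjgE tpermV => <-; rewrite mulgA.
rewrite E // [tperm b c]tpermC [tperm a b]tpermC E ?[tperm c a]tpermC //; by rewrite eq_sym.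
Qed.

Section SwapRelations.
Variable n : nat.
Local Opaque swap.

Lemma swapK (j : nat) : involutive (@swap n j).
Proof.
move=> f; rewrite (ratfunE f); move: (denom_ratioP (repr f)).
move: (repr f).1 (repr f).2 => p q q0.
rewrite (swap_frac _ _ q0) (swap_frac _ _ (msym_neq0 _ q0)).
by rewrite -!msymMm tperm2 !msym1m.
Qed.

Lemma swap_braid (j : nat) (f : ratfun n) : (0 < j)%N -> (j.+1 < n)%N ->
  swap j (swap j.+1 (swap j f)) = swap j.+1 (swap j (swap j.+1 f)).
Proof.
move=> j0 jn; rewrite (ratfunE f); move: (denom_ratioP (repr f)).
move: (repr f).1 (repr f).2 => p q q0.
rewrite !(swap_frac _ _ q0) !(swap_frac _ _ (msym_neq0 _ q0))
  !(swap_frac _ _ (msym_neq0 _ (msym_neq0 _ q0))).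
rewrite -!msymMm !mulgA /= tperm_braid //;
  by apply/eqP=> /inord_inj; lia.
Qed.

End SwapRelations.

Lemma mul_LL (n i : nat) : L n i * L n i.+1 = zvar n i.+2 / zvar n i.
Proof. by rewrite mulrC mulrA divfK ?zvar_neq0. Qed.

(** The product L_i L_{i+1} = z_{i+2} / z_i is not 1, as z_i and z_{i+2} are
distinct variables. *)
Lemma subr1LL_neq0 (n i : nat) : (0 < i)%N -> (i.+1 < n)%N ->
  1 - L n i * L n i.+1 != 0.
Proof.
move=> i0 hin; rewrite mul_LL subr_eq0 eq_sym; apply/eqP=> /divr1_eq.
move=> /eqP; rewrite tofrac_eq => /eqP /mpolyX1_inj /inord_inj; lia.
Qed.

(** * The operators as instances *)

Lemma TR_fracE (n j : nat) (a : rat) (f : ratfun n) :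
  TR_frac j a f
  = demazure_lusztig _ (@swap n j) (yvar n) (-1) (L n j) (Num.ceil a) f.
Proof.
rewrite /TR_frac /demazure_lusztig /diag_coef /refl_coef exprN1.
by rewrite mulrBl opprB addrC !mulNr; congr (- _ + _); rewrite mulrAC.
Qed.

Lemma TL_fracE (n j : nat) (a : rat) (f : ratfun n) :
  TL_frac j a f
  = demazure_lusztig _ (@swap n j) (yvar n) 1 (L n j) (Num.ceil a) f.
Proof.
rewrite /TL_frac /demazure_lusztig /diag_coef /refl_coef expr1z.
by rewrite mulrBl opprB addrC !mulNr; congr (- _ + _); rewrite mulrAC.
Qed.

Lemma swap_demazure_lusztig_braid (n i : nat) (e : int) (a b : rat)
    (f : ratfun n) :
  let D j c := demazure_lusztig _ (@swap n j) (yvar n) e (L n j) (Num.ceil c) in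
  (0 < i)%N -> (i.+1 < n)%N -> e = 1 \/ e = -1 ->
  D i b (D i.+1 (a + b) (D i a f)) = D i.+1 a (D i (a + b) (D i.+1 b f)).
Proof.
move=> D i0 hin e1; have [d ab] := ceilD_sub01 a b.
have hi : (0 < i < n)%N by lia.
have hi1 : (0 < i.+1 < n)%N by lia.
have sL : swap i (L n i) = (L n i)^-1.
  by rewrite fmorph_div /= swap_zvarl // swap_zvarr // invf_div.
have tM : swap i.+1 (L n i.+1) = (L n i.+1)^-1.
  by rewrite fmorph_div /= swap_zvarl // swap_zvarr // invf_div.
have sM : swap i (L n i.+1) = L n i * L n i.+1.
  rewrite fmorph_div /= swap_zvarr // (swap_zvar (k := i.+2)) ?mul_LL //; lia.
have tL : swap i.+1 (L n i) = L n i * L n i.+1.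
  rewrite fmorph_div /= swap_zvarl // (swap_zvar (k := i)) ?mul_LL //; lia.
have L0 j : L n j != 0 by rewrite mulf_neq0 ?invr_eq0 ?zvar_neq0.
have H := @demazure_lusztig_braid _ (@swap n i) (@swap n i.+1) (yvar n) (L n i) (L n i.+1)
  e (Num.ceil a) (Num.ceil b) (Num.ceil (a + b)) d f e1 ab (@swapK n i) (@swapK n i.+1).
have {}H := H (fun g => swap_braid n i g i0 hin) (swap_yvar hi) (swap_yvar hi1).
have {}H := H sL tM sM tL (L0 _) (L0 _) (subr1L_neq0 hi) (subr1L_neq0 hi1)
  (subr1LL_neq0 n i i0 hin).
exact: H.
Qed.

Theorem lemma11p3 (n i : nat) (T : nat -> rat -> laurent n -> laurent n)
    (lambda1 lambda2 lambda3 : rat) :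
  (3 <= n)%N -> (1 <= i <= n - 2)%N ->
  T = @TR n \/ T = @TL n ->
  T i (lambda3 - lambda2) \o T i.+1 (lambda3 - lambda1) \o T i (lambda2 - lambda1)
  =1 T i.+1 (lambda2 - lambda1) \o T i (lambda3 - lambda1)
       \o T i.+1 (lambda3 - lambda2).
Proof.
move=> n3 hi hT f; apply: val_inj.
have i0 : (0 < i)%N by lia.
have i1n : (i.+1 < n)%N by lia.
have hi0 : (0 < i < n)%N by lia.
have hi1 : (0 < i.+1 < n)%N by lia.
have -> : lambda3 - lambda1 = (lambda2 - lambda1) + (lambda3 - lambda2).
  by ring.
have [e e1 TE] : exists2 e : int, e = 1 \/ e = -1 &
    forall j a g, (0 < j < n)%N -> val (T j a g)
    = demazure_lusztig _ (@swap n j) (yvar n) e (L n j) (Num.ceil a) (val g).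
  case: hT => ->; [exists (-1); first by right | exists 1; first by left].
  - by move=> j a g hj; rewrite val_TR ?TR_fracE.
  - by move=> j a g hj; rewrite val_TL ?TL_fracE.
rewrite /comp !(TE _ _ _ hi0, TE _ _ _ hi1).
exact: swap_demazure_lusztig_braid i0 i1n e1.
Qed.
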